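(* Let $\mathcal Z=\{z\in\mathbb R^{d_z}:z\ge0,\ \mathbf 1^\top z\le1\}$, let $z\in\mathcal Z$ and let $(z,-v)\in\mathrm{gph}\,\mathcal N_{\mathcal Z}$. Let $L:=\{i\in\{1,\dots,d_z\}:z_i>0\}$. If $\mathbf 1^\top z<1$, let $\tau:=0$, $I_+:=\{i\in\{1,\dots,d_z\}:z_i=0,\ v_i>0\}$ and $I_0:=\{i\in\{1,\dots,d_z\}:z_i=0,\ v_i=0\}$. Otherwise, if $\mathbf 1^\top z=1$, then $L$ is nonempty and $v_j=v_k$ for all $j,k\in L$; let $\tau:=-v_i$ for any $i\in L$, $I_+:=\{i\in\{1,\dots,d_z\}:z_i=0,\ v_i>-\tau\}$ and $I_0:=\{i\in\{1,\dots,d_z\}:z_i=0,\ v_i=-\tau\}$. Then $$\mathcal N_{\mathrm{gph}\,\mathcal N_{\mathcal Z}}(z,-v)=\Big\{(\zeta,-\eta)\in\mathbb R^{d_z}\times\mathbb R^{d_z}:\ \exists\beta\in\mathbb R\text{ such that (1)–(4) hold}\Big\},$$ where (1) $\beta(1-\mathbf 1^\top z)=0$ and $\tau(\mathbf 1^\top\eta)=0$; (2) either $\beta>0$ and $\mathbf 1^\top\eta>0$, or $\beta\,\mathbf 1^\top\eta=0$; (3) $\zeta_i=\beta$ for all $i\in L$, and $\eta_i=0$ for all $i\in I_+$; (4) for all $i\in I_0$, either $\zeta_i<\beta$ and $\eta_i<0$, or $(\zeta_i-\beta)\eta_i=0$.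
   Context: $\mathbf 1$ is the all-one vector. For convex $\mathcal Z$, $\mathcal N_{\mathcal Z}$ is the usual normal cone mapping of convex analysis. For a nonempty set $C\subset\mathbb R^m$ and $w\in\mathrm{cl}\,C$, the proximal normal cone is $\mathcal N_C^\pi(w)=\{\zeta:\exists\sigma>0,\ \langle\zeta,w'-w\rangle\le\sigma\|w'-w\|^2\ \forall w'\in C\}$, and the limiting (Mordukhovich) normal cone is $\mathcal N_C(w)=\limsup_{w'\to w,\,w'\in C}\mathcal N_C^\pi(w')$, i.e. the set of limits of sequences $\zeta_k\in\mathcal N_C^\pi(w_k)$ with $w_k\to w$, $w_k\in C$; here it is applied to $C=\mathrm{gph}\,\mathcal N_{\mathcal Z}\subset\mathbb R^{d_z}\times\mathbb R^{d_z}$. *)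

(* Defs.v *)
From mathcomp Require Export all_boot all_order all_algebra.
From mathcomp Require Export all_classical all_reals all_analysis.
Export Order.TTheory GRing.Theory Num.Theory.
Export numFieldNormedType.Exports.

Set Implicit Arguments.
Unset Strict Implicit.
Unset Printing Implicit Defensive.

Global Open Scope classical_set_scope.
Global Open Scope ring_scope.

(* Pairs in R^d x R^d are encoded as row vectors [row_mx x y : 'rV[R]_(d + d)],
   so that the normal cones below, defined for subsets of R^m, apply to graphs
   of set-valued mappings. *)

Definition dot (R : realType) (m : nat) (x y : 'rV[R]_m) : R :=
  \sum_i x 0 i * y 0 i.

(* The library norm on row vectors is the max norm; [dot u u] is the squared
   Euclidean norm. *)
Definition sqnorm2 (R : realType) (m : nat) (u : 'rV[R]_m) : R := dot u u.

Definition convex_normal_cone (R : realType) (m : nat) (Z : set 'rV[R]_m)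
    (z : 'rV[R]_m) : set 'rV[R]_m :=
  [set nu | Z z /\ forall z', Z z' -> dot nu (z' - z) <= 0].

Definition gph (R : realType) (m n : nat) (F : 'rV[R]_m -> set 'rV[R]_n) :
    set 'rV[R]_(m + n) :=
  [set w | F (lsubmx w) (rsubmx w)].

Definition proximal_normal_cone (R : realType) (m : nat) (C : set 'rV[R]_m)
    (w : 'rV[R]_m) : set 'rV[R]_m :=
  [set zeta | exists2 sigma : R, 0 < sigma &
    forall w', C w' -> dot zeta (w' - w) <= sigma * sqnorm2 (w' - w)].

Definition limiting_normal_cone (R : realType) (m : nat) (C : set 'rV[R]_m)
    (w : 'rV[R]_m) : set 'rV[R]_m :=
  [set zeta | exists (w_ zeta_ : nat -> 'rV[R]_m),
    [/\ forall k, C (w_ k),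
        forall k, proximal_normal_cone C (w_ k) (zeta_ k),
        w_ k @[k --> \oo] --> w &
        zeta_ k @[k --> \oo] --> zeta]].

Definition capped_simplex (R : realType) (d : nat) : set 'rV[R]_d :=
  [set z | (forall i, 0 <= z 0 i) /\ \sum_i z 0 i <= 1].

Arguments capped_simplex : clear implicits.

Definition formula_cone (R : realType) (d : nat) (z : 'rV[R]_d) (tau : R)
    (L Ip I0 : set 'I_d) : set 'rV[R]_(d + d) :=
  [set w | exists zeta eta : 'rV[R]_d, w = row_mx zeta (- eta) /\
    exists beta : R,
    [/\ beta * (1 - \sum_i z 0 i) = 0 /\ tau * (\sum_i eta 0 i) = 0,
        (0 < beta /\ 0 < \sum_i eta 0 i) \/ beta * (\sum_i eta 0 i) = 0,
        (forall i, L i -> zeta 0 i = beta) /\ (forall i, Ip i -> eta 0 i = 0) &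
        forall i, I0 i ->
          (zeta 0 i < beta /\ eta 0 i < 0) \/ (zeta 0 i - beta) * eta 0 i = 0]].

(* Main.v *)
(* With the slack [s = 1 - \sum_i z_i] and its multiplier [tau], a pair [(z, -v)]
   lies in the graph iff [(s, tau)] and all [(z_i, v_i + tau)] are complementary
   pairs of nonnegative numbers. Normals split accordingly, into one normal
   [(- beta, - \sum_i eta_i)] and the normals [(zeta_i - beta, eta_i)] to the
   planar complementarity set. Proximal normals are identified by testing short
   segments of the graph and, conversely, by quadratic estimates for each pair
   (the multiplier [tau] is a Lipschitz function of [v] along the graph). In the
   limit, the conditions on the pairs are closed; conversely, each biactive pair
   [(0, 0)] with a non-proximal normal is moved onto the branch of the
   complementarity set on which this normal is proximal. *)
Require Import Defs.
From mathcomp Require Import ring lra.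

Set Implicit Arguments.
Unset Strict Implicit.

(** * Dot products, coordinate sums and first-order tests of proximal normals *)

Section Dot.
Context {R : realType} {m : nat}.
Implicit Types (x y : 'rV[R]_m) (t : R).

Lemma dotDr x y y' : dot x (y + y') = dot x y + dot x y'.
Proof.
by rewrite /dot -big_split; apply: eq_bigr => i _; rewrite mxE mulrDr.
Qed.

Lemma dotZr x t y : dot x (t *: y) = t * dot x y.
Proof. by rewrite /dot mulr_sumr; apply: eq_bigr => i _; rewrite mxE; ring. Qed.

Lemma dotNr x y : dot x (- y) = - dot x y.
Proof. by rewrite -scaleN1r dotZr mulN1r. Qed.

Lemma dot0r x : dot x 0 = 0.
Proof. by rewrite -(scale0r 0) dotZr mul0r. Qed.

Lemma dotC x y : dot x y = dot y x.
Proof. by apply: eq_bigr => i _; rewrite mulrC. Qed.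

Lemma dotNl x y : dot (- x) y = - dot x y.
Proof. by rewrite dotC dotNr dotC. Qed.

Lemma dot_delta x i : dot x (delta_mx 0 i) = x 0 i.
Proof.
rewrite /dot (bigD1 i) //= big1 ?mxE ?eqxx ?mulr1 ?addr0// => j ji.
by rewrite mxE (negbTE ji) mulr0.
Qed.

Lemma dot_ones x : dot x (const_mx 1) = \sum_i x 0 i.
Proof. by apply: eq_bigr => i _; rewrite mxE mulr1. Qed.

Lemma sqnorm2_ge0 x : 0 <= sqnorm2 x.
Proof. by apply: sumr_ge0 => i _; rewrite -expr2 sqr_ge0. Qed.

Lemma sqnorm2Z t x : sqnorm2 (t *: x) = t ^+ 2 * sqnorm2 x.
Proof. by rewrite /sqnorm2 dotZr dotC dotZr; ring. Qed.

Lemma sqnorm2N x : sqnorm2 (- x) = sqnorm2 x.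
Proof. by rewrite /sqnorm2 dotNl dotNr opprK. Qed.

Lemma sqr_entry_le_sqnorm2 x i : x 0 i ^+ 2 <= sqnorm2 x.
Proof.
rewrite /sqnorm2 /dot (bigD1 i) //= -expr2 lerDl.
by apply: sumr_ge0 => j _; rewrite -expr2 sqr_ge0.
Qed.

Lemma entryB x y i : (x - y) 0 i = x 0 i - y 0 i.
Proof. by rewrite !mxE. Qed.

Lemma sum_entriesD x y :
  \sum_i (x + y) 0 i = \sum_i x 0 i + \sum_i y 0 i.
Proof. by rewrite -big_split; apply: eq_bigr => i _; rewrite mxE. Qed.

Lemma sum_entriesZ t x : \sum_i (t *: x) 0 i = t * \sum_i x 0 i.
Proof. by rewrite mulr_sumr; apply: eq_bigr => i _; rewrite mxE. Qed.

Lemma sum_entriesN x : \sum_i (- x) 0 i = - \sum_i x 0 i.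
Proof. by rewrite -sumrN; apply: eq_bigr => i _; rewrite mxE. Qed.

Lemma sum_entries_delta i : \sum_j (delta_mx 0 i : 'rV[R]_m) 0 j = 1.
Proof. by rewrite -dot_ones dotC dot_delta mxE. Qed.

(** Along the segment the left side of the proximal inequality is linear in [t] and the right side
    quadratic, so a positive slope fails for small [t]. *)
Lemma proximal_direction (C : set 'rV[R]_m) w u zeta (T : R) :
  0 < T -> (forall t, 0 < t -> t <= T -> C (w + t *: u)) ->
  proximal_normal_cone C w zeta -> dot zeta u <= 0.
Proof.
move=> T0 Cw [s s0 H]; rewrite leNgt; apply/negP => du.
have K0 : 0 < 1 + s * sqnorm2 u by rewrite ltr_wpDr// mulr_ge0// ?sqnorm2_ge0// ltW.
(* For this [t], [t * s * sqnorm2 u] is strictly below [dot zeta u]; the summand 1 keeps the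
   denominator positive and the inequality strict. *)
pose t := Num.min T (dot zeta u / (1 + s * sqnorm2 u)).
have t0 : 0 < t by rewrite lt_min T0 divr_gt0.
have tT : t <= T by rewrite ge_min lexx.
have : t * (1 + s * sqnorm2 u) <= dot zeta u.
  by rewrite -ler_pdivlMr// ge_min lexx orbT.
have := H _ (Cw t t0 tT); rewrite [w + _]addrC addrK dotZr sqnorm2Z.
rewrite expr2 -mulrA mulrCA ler_pM2l// mulrCA => le1 le2; nra.
Qed.

End Dot.

Lemma dot_row_mx (R : realType) (m n : nat) (x x' : 'rV[R]_m) (y y' : 'rV[R]_n) :
  dot (row_mx x y) (row_mx x' y') = dot x x' + dot y y'.
Proof.
rewrite /dot big_split_ord; congr (_ + _); apply: eq_bigr => i _.
  by rewrite !row_mxEl.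
by rewrite !row_mxEr.
Qed.

(* The optimality system of [capped_simplex] at [z] with normal vector [- v]:
   [tau] is the multiplier of [\sum_i z 0 i <= 1] and [v 0 i + tau] that of
   [0 <= z 0 i]. *)
Definition kkt (R : realType) (d : nat) (z v : 'rV[R]_d) (tau : R) :=
  [/\ capped_simplex R d z, 0 <= tau, (1 - \sum_i z 0 i) * tau = 0 &
      forall i, 0 <= v 0 i + tau /\ z 0 i * (v 0 i + tau) = 0].

(** * The graph of the normal cone mapping through its multiplier *)

Section Graph.
Context {R : realType} {d : nat}.
Implicit Types (z v : 'rV[R]_d) (t tau : R).

Lemma capped_simplex_up z i t : capped_simplex R d z ->
  0 <= t -> t <= 1 - \sum_i z 0 i -> capped_simplex R d (z + t *: delta_mx 0 i).
Proof.
move=> [z0 z1] t0 tz; split=> [j|].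
  by rewrite !mxE addr_ge0// mulr_ge0.
by rewrite sum_entriesD sum_entriesZ sum_entries_delta; lra.
Qed.

Lemma capped_simplex_down z i t : capped_simplex R d z ->
  0 <= t -> t <= z 0 i -> capped_simplex R d (z - t *: delta_mx 0 i).
Proof.
move=> [z0 z1] t0 tz; split=> [j|].
  rewrite !mxE eqxx/=; have := z0 j.
  by case: eqVneq => [->|_] /=; lra.
by rewrite sum_entriesD sum_entriesN sum_entriesZ sum_entries_delta; lra.
Qed.

Lemma capped_simplex_swap z i j t : capped_simplex R d z ->
  0 <= t -> t <= z 0 j ->
  capped_simplex R d (z + t *: (delta_mx 0 i - delta_mx 0 j)).
Proof.
move=> hz t0 tz; rewrite scalerBr addrCA addrC.
have hz' := capped_simplex_down hz t0 tz.
apply: capped_simplex_up => //; case: hz => z0 z1.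
by rewrite sum_entriesD sum_entriesN sum_entriesZ sum_entries_delta; lra.
Qed.

Lemma capped_simplex_tight z : capped_simplex R d z -> \sum_i z 0 i = 1 ->
  exists j, 0 < z 0 j.
Proof.
move=> [z0 _] z1; apply/not_existsP => nz.
suff: \sum_i z 0 i = 0 by move/eqP; rewrite z1 oner_eq0.
apply: big1 => i _; apply/eqP; rewrite eq_le z0 andbT leNgt.
by apply/negP/nz.
Qed.

(** Sufficiency is weak duality. For necessity, feasible moves of one or two coordinates are tested:
    the multiplier is 0 when there is slack, and otherwise [- v 0 j] for any [j] in the support. *)
Lemma graphP z v :
  gph (convex_normal_cone (capped_simplex R d)) (row_mx z (- v)) <->
  exists tau, kkt z v tau.
Proof.
rewrite /gph /= row_mxKl row_mxKr.
split=> [[hz N]|[tau [hz tau0 tz vz]]]; last first.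
  split=> // z' [z'0 z'1]; rewrite dotNl /dot oppr_le0.
  have -> : \sum_i v 0 i * (z' - z) 0 i =
      \sum_i ((v 0 i + tau) * z' 0 i - z 0 i * (v 0 i + tau)
              + (tau * z 0 i - tau * z' 0 i)).
    by apply: eq_bigr => i _; rewrite !mxE; ring.
  rewrite big_split /= addr_ge0//.
    by apply: sumr_ge0 => i _; have [? ->] := vz i; rewrite subr0 mulr_ge0.
  rewrite sumrB -!mulr_sumr.
  have := mulr_ge0 tau0 (_ : 0 <= 1 - \sum_i z' 0 i).
  by rewrite subr_ge0 => /(_ z'1); lra.
have down i : 0 < z 0 i -> 0 <= - v 0 i.
  move=> zi; have := N _ (capped_simplex_down hz (ltW zi) (lexx _)).
  rewrite [z - _]addrC addrK dotNl dotNr dotZr dot_delta; nra.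
have [z1|z1] := ltP (\sum_i z 0 i) 1.
  exists 0; split=> //; first by rewrite mulr0.
  move=> i; rewrite addr0.
  have vi : 0 <= v 0 i.
    have s0 : 0 < 1 - \sum_i z 0 i by rewrite subr_gt0.
    have := N _ (capped_simplex_up i hz (ltW s0) (lexx _)).
    rewrite [z + _]addrC addrK dotNl dotZr dot_delta; nra.
  split=> //; have := hz.1 i; rewrite le_eqVlt => /predU1P[<-|zi].
    by rewrite mul0r.
  by have -> : v 0 i = 0 by [have := down i zi; lra]; rewrite mulr0.
have {}z1 : \sum_i z 0 i = 1 by apply/eqP; rewrite eq_le z1 hz.2.
have [j zj] := capped_simplex_tight hz z1.
(* Moving all mass of [k] to [i] preserves the sum, so it is feasible even when the cap is tight;
   hence [v] is minimal, and constant, on the support. *)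
have swap i k : 0 < z 0 k -> v 0 k <= v 0 i.
  move=> zk; have := N _ (capped_simplex_swap i hz (ltW zk) (lexx _)).
  rewrite [z + _]addrC addrK dotNl dotZr dotDr dotNr !dot_delta; nra.
exists (- v 0 j); split=> //; first exact: down.
  by rewrite z1 subrr mul0r.
move=> i; split; first by rewrite subr_ge0 swap.
have := hz.1 i; rewrite le_eqVlt => /predU1P[<-|zi]; first by rewrite mul0r.
by have := swap i j zj; have := swap j i zi; nra.
Qed.

End Graph.

(** Cauchy-Schwarz against the all-one vector, read off from the nonnegative sum of squared
    deviations from the mean. *)
Lemma sqr_sum_entries_le (R : realType) (d : nat) (x : 'rV[R]_d) :
  (\sum_i x 0 i) ^+ 2 <= d%:R * sqnorm2 x.
Proof.
case: d x => [|d] x; first by rewrite big_ord0 expr0n/= mul0r.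
set s := \sum_i _.
have : 0 <= \sum_i (d.+1%:R * x 0 i - s) ^+ 2.
  by apply: sumr_ge0 => i _; rewrite sqr_ge0.
have -> : \sum_i (d.+1%:R * x 0 i - s) ^+ 2 =
    \sum_i (d.+1%:R ^+ 2 * (x 0 i * x 0 i) - 2 * d.+1%:R * s * x 0 i + s ^+ 2).
  by apply: eq_bigr => i _; ring.
rewrite big_split sumrB /= -!mulr_sumr -/s sumr_const card_ord.
rewrite -/(dot x x) -/(sqnorm2 x) => h.
have n0 : 0 < d.+1%:R :> R by rewrite ltr0n.
rewrite -(ler_pM2l n0); lra.
Qed.

(* A complementary pair [(x, m)], i.e. a point of
   [{x >= 0, m >= 0, x * m = 0}], with limiting, resp. proximal, normal
   [(a, b)] to this set there. *)
Definition limiting_pair (R : realType) (x m a b : R) :=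
  [/\ x * a = 0, m * b = 0 & (a < 0 /\ b < 0) \/ a * b = 0].

Definition proximal_pair (R : realType) (x m a b : R) :=
  [/\ x * a = 0, m * b = 0 & x = 0 -> m = 0 -> a <= 0 /\ b <= 0].

(** * Normals to the planar complementarity set *)

Section Pair.
Context {R : realType}.
Implicit Types x m a b : R.

Lemma proximal_limiting_pair x m a b :
  proximal_pair x m a b -> limiting_pair x m a b.
Proof.
move=> [xa mb nab]; split=> //.
have [x0|x0] := eqVneq x 0; last first.
  by right; move/eqP: xa; rewrite mulf_eq0 (negbTE x0) => /eqP->; rewrite mul0r.
have [m0|m0] := eqVneq m 0; last first.
  by right; move/eqP: mb; rewrite mulf_eq0 (negbTE m0) => /eqP->; rewrite mulr0.
have [] := nab x0 m0; rewrite le_eqVlt => /predU1P[->|a0].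
  by right; rewrite mul0r.
by rewrite le_eqVlt => /predU1P[->|b0]; [right; rewrite mulr0|left].
Qed.

Lemma proximal_pair_bound x m a b : 0 <= x -> 0 <= m -> x * m = 0 ->
  proximal_pair x m a b ->
  exists2 s, 0 <= s & forall x' m', 0 <= x' -> 0 <= m' -> x' * m' = 0 ->
    a * (x' - x) + b * (m' - m) <= s * ((x' - x) ^+ 2 + (m' - m) ^+ 2).
Proof.
(* A nonzero [n'] forces [y' = 0], a jump of size [y]: thus [y * n' = - (y' - y) * n'], a product of
   two increments, hence quadratic. *)
have half (c y y' n' : R) : 0 < y -> y' * n' = 0 ->
    c * n' <= `|c| / y * ((y' - y) ^+ 2 + n' ^+ 2).
  move=> y0 yn.
  have -> : c * n' = (c / y) * - ((y' - y) * n').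
    by rewrite mulrBl yn sub0r opprK mulrA divfK// gt_eqF.
  have -> : `|c| / y = `|c / y| by rewrite normrM normfV (gtr0_norm y0).
  apply: le_trans (ler_norm _) _; rewrite normrM ler_wpM2l//.
  move: (y' - y) => t; have := sqr_ge0 (t + n'); have := sqr_ge0 (t - n').
  have := sqr_ge0 t; have := sqr_ge0 n'.
  by rewrite ler_norml => ? ? ? ?; apply/andP; split; nra.
move=> x0 m0 xm [xa mb nab].
move: x0; rewrite le_eqVlt => /predU1P[x0|x0].
  move: m0; rewrite le_eqVlt => /predU1P[m0|m0].
    exists 0 => // x' m' x'0 m'0 _; have [a0 b0] := nab (esym x0) (esym m0).
    rewrite -x0 -m0; nra.
  have b0 : b = 0 by nra.
  exists (`|a| / m); first by rewrite divr_ge0// ltW.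
  move=> x' m' _ _ xm'; rewrite b0 mul0r addr0 -x0 subr0 addrC.
  by apply: half => //; rewrite mulrC.
have [a0 m00] : a = 0 /\ m = 0 by split; nra.
exists (`|b| / x); first by rewrite divr_ge0// ltW.
by move=> x' m' _ _ xm'; rewrite a0 mul0r add0r m00 subr0; apply: half.
Qed.

(** The direction [pq] must serve all step sizes [e], and the factor [c] leaves room for rescaling
    [z] so that slack and coordinates can be perturbed together. *)
Lemma perturb_pair x m a b : 0 <= x -> 0 <= m -> x * m = 0 ->
  limiting_pair x m a b ->
  exists pq : R * R, [/\ 0 <= pq.1, 0 <= pq.2 &
    forall c e, 0 < c -> 0 < e ->
      (c * x + e * pq.1) * (m + e * pq.2) = 0 /\
      proximal_pair (c * x + e * pq.1) (m + e * pq.2) a b].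
Proof.
move=> x0 m0 xm [xa mb ab].
have [xm0|/eqP xm0] := eqVneq (x + m) 0; last first.
  exists (0, 0); split=> // c e c0 e0 /=; rewrite !mulr0 !addr0.
  split; first by rewrite -mulrA xm mulr0.
  split=> //; first by rewrite -mulrA xa mulr0.
  by move=> cx mm; exfalso; apply: xm0; nra.
have [-> ->] : x = 0 /\ m = 0 by split; lra.
have [[a0 b0]|nab] := pselect (a <= 0 /\ b <= 0).
  by exists (0, 0); split=> // c e _ _ /=; rewrite !mulr0 !addr0 mulr0; split=> //;
    split=> //; rewrite mul0r.
have {}ab : a * b = 0 by case: ab => [[a0 b0]|//]; exfalso;
  apply: nab; split; apply: ltW.
(* The branch [x > 0], [m = 0] has proximal normals [(0, b)] and the branch [x = 0], [m > 0] has
   [(a, 0)], with no sign restriction. *)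
have [a0|a0] := eqVneq a 0.
  exists (1, 0); split=> // c e c0 e0 /=; rewrite !mulr0 !mulr1 addr0 add0r a0.
  by rewrite mulr0; split=> //; split=> [||e00]; rewrite ?mul0r ?mulr0//; lra.
have {}b0 : b = 0 by move/eqP: ab; rewrite mulf_eq0 (negbTE a0) => /eqP.
exists (0, 1); split=> // c e c0 e0 /=; rewrite !mulr0 !mulr1 addr0 add0r b0.
by rewrite mul0r; split=> //; split=> [||_ e00]; rewrite ?mul0r ?mulr0//; lra.
Qed.

(** The equations pass to the limit; the alternative fails only where [a * b < 0] or both [a] and
    [b] are positive, and these conditions are open. *)
Lemma limiting_pair_cvg (x_ m_ a_ b_ : nat -> R) x m a b :
  x_ k @[k --> \oo] --> x -> m_ k @[k --> \oo] --> m ->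
  a_ k @[k --> \oo] --> a -> b_ k @[k --> \oo] --> b ->
  (\forall k \near \oo, limiting_pair (x_ k) (m_ k) (a_ k) (b_ k)) ->
  limiting_pair x m a b.
Proof.
move=> cx cm ca cb H.
have lim0 (f_ : nat -> R) l : f_ k @[k --> \oo] --> l ->
    (\forall k \near \oo, f_ k = 0) -> l = 0.
  move=> cf f0; apply/esym/(@cvg_unique _ (@Rhausdorff R) (f_ k @[k --> \oo])).
    by apply: cvg_near_cst; exact: f0.
  exact: cf.
split.
- by apply: (lim0 _ _ (cvgM cx ca)); apply: filterS H => k [].
- by apply: (lim0 _ _ (cvgM cm cb)); apply: filterS H => k [].
have [ab|ab|ab] := ltgtP (a * b) 0; [|left|by right].
  have [k [[_ _ ab']]] := filter_ex (filterI H (cvgr_lt _ (cvgM ca cb) _ ab)).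
  by rewrite /=; case: ab' => [[]|]; nra.
have [a0|a0] := ltP a 0; first by split=> //; nra.
have a1 : 0 < a.
  by rewrite lt0r a0 andbT; apply: contraTneq ab => ->; rewrite mul0r ltxx.
have b1 : 0 < b by rewrite -(pmulr_rgt0 _ a1).
have [k [[[_ _ ab']]]] :=
  filter_ex (filterI (filterI H (cvgr_gt _ ca _ a1)) (cvgr_gt _ cb _ b1)).
by rewrite /=; case: ab' => [[]|]; nra.
Qed.

End Pair.

(** * Multipliers, and sufficiency for proximal normals *)

Section Multiplier.
Context {R : realType} {d : nat}.
Implicit Types (z v zeta eta : 'rV[R]_d) (tau beta : R).

(* The slack [1 - \sum_i z 0 i] and its multiplier [tau] are treated on the same
   footing as the pairs [(z 0 i, v 0 i + tau)]; their conormal coordinates are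
   [- beta] and [- \sum_i eta 0 i]. *)
Definition multiplier (P : R -> R -> R -> R -> Prop) z v tau zeta eta beta :=
  P (1 - \sum_i z 0 i) tau (- beta) (- \sum_i eta 0 i) /\
  forall i, P (z 0 i) (v 0 i + tau) (zeta 0 i - beta) (eta 0 i).

Lemma kkt_slack_ge0 z v tau : kkt z v tau -> 0 <= 1 - \sum_i z 0 i.
Proof. by move=> [[_ ?] _ _ _]; rewrite subr_ge0. Qed.

(** If the larger multiplier is positive, its cap is tight, so it equals minus the [v]-entry at some
    support index [j]; the smaller one is at least minus its own entry at [j]. *)
Lemma kkt_sqr_dist_le z v tau z' v' tau' : kkt z v tau -> kkt z' v' tau' ->
  (tau' - tau) ^+ 2 <= sqnorm2 (v' - v).
Proof.
have sqr_dist_le (u y u' y' : 'rV[R]_d) (t t' : R) : kkt u y t -> kkt u' y' t' -> t <= t' ->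
    (t' - t) ^+ 2 <= sqnorm2 (y' - y).
  move=> [hu t0 ut uy] [hu' t'0 ut' uy'] tt'.
  have [t'00|t'p] := eqVneq t' 0.
    have -> : t' - t = 0 by lra.
    by rewrite expr0n/= sqnorm2_ge0.
  have /(capped_simplex_tight hu')[j uj] : \sum_i u' 0 i = 1.
    move/eqP: ut'; rewrite mulf_eq0 (negbTE t'p) orbF subr_eq0 => /eqP->//.
  apply: le_trans (sqr_entry_le_sqnorm2 _ j); rewrite !mxE.
  have [y'j uyj] := uy' j; have [yj _] := uy j.
  have t'E : y' 0 j + t' = 0.
    by move/eqP: uyj; rewrite mulf_eq0 gt_eqF// => /eqP.
  nra.
move=> h h'; have [|/ltW] := leP tau tau'; first exact: sqr_dist_le h h'.
move=> /(sqr_dist_le _ _ _ _ _ _ h' h); rewrite -[v' - v]opprB sqnorm2N.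
by rewrite -[tau' - tau]opprB sqrrN.
Qed.

Lemma multiplier_proximal z v tau zeta eta beta : kkt z v tau ->
  multiplier (@proximal_pair R) z v tau zeta eta beta ->
  proximal_normal_cone (gph (convex_normal_cone (capped_simplex R d)))
    (row_mx z (- v)) (row_mx zeta (- eta)).
Proof.
move=> hz [h0 h]; have [[z0 _] tau0 tz vz] := hz.
have [s0 s00 H0] := proximal_pair_bound (kkt_slack_ge0 hz) tau0 tz h0.
have /choice[s Hs] i : exists s, 0 <= s /\ forall x' m', 0 <= x' -> 0 <= m' ->
    x' * m' = 0 -> (zeta 0 i - beta) * (x' - z 0 i)
      + eta 0 i * (m' - (v 0 i + tau))
    <= s * ((x' - z 0 i) ^+ 2 + (m' - (v 0 i + tau)) ^+ 2).
  have [vi zvi] := vz i.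
  by have [s s_ge0 Hs] := proximal_pair_bound (z0 i) vi zvi (h i); exists s.
have S0 : 0 <= s0 + \sum_i s i.
  by rewrite addr_ge0// sumr_ge0// => i _; have [] := Hs i.
have K0 : 0 <= d%:R + 5 :> R by rewrite addr_ge0.
(* The squared increments of the slack pair sum to at most [d + 1] times the squared distance, those
   of a coordinate pair to at most 4 times; [d + 5] covers both, and the last 1 makes the constant
   positive. *)
exists ((s0 + \sum_i s i) * (d%:R + 5) + 1).
  by rewrite ltr_wpDl// mulr_ge0.
move=> w'; rewrite -[w']hsubmxK; set z' := lsubmx w'.
rewrite -[rsubmx w']opprK; set v' := - rsubmx w' => /graphP[tau' hz'].
have [[z'0 _] tau'0 tz' vz'] := hz'.
rewrite opp_row_mx add_row_mx dot_row_mx.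
have -> (x y : 'rV[R]_d) : sqnorm2 (row_mx x y) = sqnorm2 x + sqnorm2 y.
  exact: dot_row_mx.
have -> : - v' - - v = - (v' - v) by rewrite opprD.
rewrite dotNl dotNr opprK sqnorm2N.
set dz := z' - z; set dv := v' - v; set N := sqnorm2 dz + sqnorm2 dv.
have dz0 := sqnorm2_ge0 dz; have dv0 := sqnorm2_ge0 dv.
have dtau : (tau' - tau) ^+ 2 <= N.
  by have := kkt_sqr_dist_le hz hz'; rewrite -/dv /N; lra.
(* The pairing splits over the pairs: the contributions of [beta] and of [tau' - tau] in the slack
   pair cancel those in the coordinate pairs. *)
have -> : dot zeta dz + dot eta dv =
    - beta * ((1 - \sum_i z' 0 i) - (1 - \sum_i z 0 i))
    + - (\sum_i eta 0 i) * (tau' - tau)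
    + \sum_i ((zeta 0 i - beta) * (z' 0 i - z 0 i)
      + eta 0 i * (v' 0 i + tau' - (v 0 i + tau))).
  have -> : \sum_i ((zeta 0 i - beta) * (z' 0 i - z 0 i)
      + eta 0 i * (v' 0 i + tau' - (v 0 i + tau))) =
    \sum_i ((zeta 0 i * dz 0 i + eta 0 i * dv 0 i) +
      (- beta * z' 0 i + beta * z 0 i + (tau' - tau) * eta 0 i)).
    by apply: eq_bigr => i _; rewrite !mxE; ring.
  rewrite !big_split /= -!mulr_sumr /dot; ring.
apply: (@le_trans _ _ ((s0 + \sum_i s i) * (d%:R + 5) * N)); last first.
  by rewrite ler_wpM2r ?lerDl// addr_ge0.
rewrite [_ * _ * N]mulrAC -mulrA mulrDl mulr_suml; apply: lerD.
  apply: le_trans (H0 _ _ (kkt_slack_ge0 hz') tau'0 tz') _; apply: ler_wpM2l => //.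
  have -> : 1 - \sum_i z' 0 i - (1 - \sum_i z 0 i) = - \sum_i dz 0 i.
    by rewrite sum_entriesD sum_entriesN; ring.
  rewrite sqrrN; have := sqr_sum_entries_le dz.
  have : 0 <= d%:R * sqnorm2 dv by rewrite mulr_ge0.
  rewrite /N in dtau *; lra.
apply: ler_sum => i _; have [si Hi] := Hs i; have [v'i zv'i] := vz' i.
apply: le_trans (Hi _ _ (z'0 i) v'i zv'i) _; apply: ler_wpM2l => //.
have <- : dz 0 i = z' 0 i - z 0 i by rewrite entryB.
have -> : v' 0 i + tau' - (v 0 i + tau) = dv 0 i + (tau' - tau).
  by rewrite entryB; ring.
have := sqr_entry_le_sqnorm2 dz i; have := sqr_entry_le_sqnorm2 dv i.
have := sqr_ge0 (dv 0 i - (tau' - tau)).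
have : 0 <= d%:R * N by rewrite mulr_ge0// addr_ge0.
move: dtau; rewrite /N; nra.
Qed.

End Multiplier.

(** * Necessity for proximal normals, and passage to limiting normals *)

Section Limiting.
Context {R : realType} {d : nat}.
Implicit Types (z v zeta eta : 'rV[R]_d) (tau beta : R).

Local Notation graph := (gph (convex_normal_cone (capped_simplex R d))).

Lemma proximal_multiplier z v tau zeta eta : kkt z v tau ->
  proximal_normal_cone graph (row_mx z (- v)) (row_mx zeta (- eta)) ->
  exists beta, multiplier (@proximal_pair R) z v tau zeta eta beta.
Proof.
move=> [hz tau0 tz vz] prox; have z0 := hz.1.
(* Two families of segments in the graph: [z] moves with [v] and [tau] fixed, or [z] is fixed while
   [v] moves and [tau] follows at rate [s]. *)
have z_dir u T : 0 < T -> (forall t, 0 < t -> t <= T -> kkt (z + t *: u) v tau) ->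
    dot zeta u <= 0.
  move=> T0 H; have := @proximal_direction _ _ graph _ (row_mx u 0) _ _ T0 _ prox.
  rewrite dot_row_mx dot0r addr0; apply.
  move=> t t0 tT; rewrite scale_row_mx add_row_mx scaler0 addr0.
  by apply/graphP; exists tau; apply: H.
have v_dir u s T : 0 < T ->
    (forall t, 0 < t -> t <= T -> kkt z (v + t *: u) (tau + t * s)) ->
    dot eta u <= 0.
  move=> T0 H; have := @proximal_direction _ _ graph _ (row_mx 0 (- u)) _ _ T0 _ prox.
  rewrite dot_row_mx dot0r add0r dotNl dotNr opprK; apply.
  move=> t t0 tT; rewrite scale_row_mx add_row_mx scaler0 addr0 scalerN -opprD.
  by apply/graphP; exists (tau + t * s); apply: H.
have eta_le0 i : z 0 i = 0 -> eta 0 i <= 0.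
  move=> zi; rewrite -dot_delta; apply: (v_dir _ 0 1 ltr01) => t t0 _.
  rewrite mulr0 addr0; split=> // j; have [vj zvj] := vz j; rewrite !mxE eqxx/=.
  by case: (eqVneq j i) vj zvj => [->|ji] /= vj zvj; rewrite ?zi; split; lra.
have eta_ge0 i : z 0 i = 0 -> 0 < v 0 i + tau -> 0 <= eta 0 i.
  move=> zi vi; rewrite -oppr_le0 -dot_delta -dotNr; apply: (v_dir _ 0 _ vi) => t t0 tT.
  rewrite mulr0 addr0; split=> // j; have [vj zvj] := vz j; rewrite !mxE eqxx/=.
  by case: (eqVneq j i) vj zvj => [->|ji] /= vj zvj; rewrite ?zi; split; lra.
(* When the cap is tight, [tau] can be raised while every entry of [v] is lowered equally, leaving
   all [v 0 i + tau] unchanged. *)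
have sum_ge0 : 1 - \sum_i z 0 i = 0 -> 0 <= \sum_i eta 0 i.
  move=> z1; rewrite -oppr_le0 -dot_ones -dotNr; apply: (v_dir _ 1 1 ltr01) => t t0 _.
  split=> //; [lra|by rewrite z1 mul0r|].
  move=> j; have [vj zvj] := vz j; rewrite !mxE.
  by have -> : v 0 j + t * - 1 + (tau + t * 1) = v 0 j + tau by ring.
have sum_le0 : 1 - \sum_i z 0 i = 0 -> 0 < tau -> \sum_i eta 0 i <= 0.
  move=> z1 taup; rewrite -dot_ones; apply: (v_dir _ (- 1) _ taup) => t t0 tT.
  split=> //; [lra|by rewrite z1 mul0r|].
  move=> j; have [vj zvj] := vz j; rewrite !mxE.
  by have -> : v 0 j + t * 1 + (tau + t * - 1) = v 0 j + tau by ring.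
have zeta_up i : v 0 i + tau = 0 -> 0 < 1 - \sum_i z 0 i -> zeta 0 i <= 0.
  move=> vi s0; have tau00 : tau = 0 by nra.
  rewrite -dot_delta; apply: (z_dir _ _ s0) => t t0 tT; split=> //.
  - by apply: capped_simplex_up => //; exact: ltW.
  - by rewrite tau00 mulr0.
  move=> j; have [vj zvj] := vz j; split=> //; rewrite !mxE eqxx/=.
  by case: (eqVneq j i) vj zvj => [->|ji] /= vj zvj; rewrite ?vi; lra.
have zeta_down i : 0 < z 0 i -> tau = 0 -> 0 <= zeta 0 i.
  move=> zi tau00.
  rewrite -oppr_le0 -dot_delta -dotNr; apply: (z_dir _ _ zi) => t t0 tT; split=> //.
  - by rewrite scalerN; apply: capped_simplex_down => //; exact: ltW.
  - by rewrite tau00 mulr0.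
  move=> j; have [vj zvj] := vz j; split=> //; rewrite !mxE eqxx/=.
  case: (eqVneq j i) => [jE|ji] /=; last lra.
  by rewrite jE in zvj *; have -> : v 0 i + tau = 0 by [nra]; rewrite mulr0.
have zeta_swap i j : v 0 i + tau = 0 -> 0 < z 0 j -> zeta 0 i <= zeta 0 j.
  move=> vi zj; rewrite -subr_le0 -!dot_delta -dotNr -dotDr.
  apply: (z_dir _ _ zj) => t t0 tT; split=> //.
  - by apply: capped_simplex_swap => //; exact: ltW.
  - rewrite sum_entriesD sum_entriesZ sum_entriesD sum_entriesN.
    by rewrite !sum_entries_delta subrr mulr0 addr0.
  move=> k; have [vk zvk] := vz k; split=> //; rewrite !mxE eqxx/=.
  have vj : v 0 j + tau = 0 by have [_ ?] := vz j; nra.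
  case: (eqVneq k i) => [->|_]; first by rewrite vi mulr0.
  by case: (eqVneq k j) => [->|_] /=; [rewrite vj mulr0|lra].
have vz0 i : 0 < z 0 i -> v 0 i + tau = 0 by move=> zi; have [_ ?] := vz i; nra.
have zv0 i : 0 < v 0 i + tau -> z 0 i = 0 by move=> vi; have [_ ?] := vz i; nra.
have b0 i : (v 0 i + tau) * eta 0 i = 0.
  have [vi _] := vz i; move: vi; rewrite le_eqVlt => /predU1P[<-|vi].
    by rewrite mul0r.
  have zi := zv0 i vi.
  have -> : eta 0 i = 0 by apply/eqP; rewrite eq_le eta_le0 ?eta_ge0.
  by rewrite mulr0.
have s_ge0 : 0 <= 1 - \sum_i z 0 i by rewrite subr_ge0 hz.2.
move: s_ge0; rewrite le_eqVlt => /predU1P[/esym s0|s0].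
  have [|j zj] := capped_simplex_tight hz; first by lra.
  (* By [zeta_swap], [zeta] is constant on the support, and this constant is [beta]. *)
  exists (zeta 0 j); split; [split|move=> i; split] => //.
  - by rewrite s0 mul0r.
  - move: tau0; rewrite le_eqVlt => /predU1P[<-|taup]; first by rewrite mul0r.
    have -> : \sum_i eta 0 i = 0 by apply/eqP; rewrite eq_le sum_le0 ?sum_ge0.
    by rewrite oppr0 mulr0.
  - by move=> _ tau00; have := zeta_down _ zj tau00; have := sum_ge0 s0; lra.
  - have := z0 i; rewrite le_eqVlt => /predU1P[<-|zi]; first by rewrite mul0r.
    have -> : zeta 0 i = zeta 0 j.
      by apply/eqP; rewrite eq_le !zeta_swap// vz0.
    by rewrite subrr mulr0.
  - by move=> zi vi; split; [rewrite subr_le0 zeta_swap|exact: eta_le0].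
have tau00 : tau = 0 by nra.
exists 0; split; [split|move=> i; split] => //.
- by rewrite oppr0 mulr0.
- by rewrite tau00 mul0r.
- by move=> s00; lra.
- have := z0 i; rewrite le_eqVlt => /predU1P[<-|zi]; first by rewrite mul0r.
  have -> : zeta 0 i = 0 by apply/eqP; rewrite eq_le zeta_up ?zeta_down ?vz0.
  by rewrite subrr mulr0.
- by move=> zi vi; split; [rewrite subr0 zeta_up|exact: eta_le0].
Qed.

Lemma multiplier_limiting z v tau zeta eta beta : kkt z v tau ->
  multiplier (@limiting_pair R) z v tau zeta eta beta ->
  limiting_normal_cone graph (row_mx z (- v)) (row_mx zeta (- eta)).
Proof.
move=> hz [h0 h]; have [[z0 _] tau0 tz vz] := hz.
have [[p0 q0] /= [p00 q00 H0]] := perturb_pair (kkt_slack_ge0 hz) tau0 tz h0.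
have /choice[pq Hpq] i : exists pq : R * R, [/\ 0 <= pq.1, 0 <= pq.2 &
    forall c e, 0 < c -> 0 < e ->
      (c * z 0 i + e * pq.1) * (v 0 i + tau + e * pq.2) = 0 /\
      proximal_pair (c * z 0 i + e * pq.1) (v 0 i + tau + e * pq.2)
        (zeta 0 i - beta) (eta 0 i)].
  by have [vi zvi] := vz i; exact: perturb_pair (z0 i) vi zvi (h i).
(* The weight [c] makes [z + e (p - c z)] have slack
   [(1 - c e) (1 - \sum_i z 0 i) + e p0]. *)
pose c := p0 + \sum_i (pq i).1.
have c0 : 0 <= c by rewrite addr_ge0// sumr_ge0// => i _; have [] := Hpq i.
(* The harmonic factor is at most 1 and tends to 0; dividing by [1 + c] keeps [e k * c < 1] for
   every [k]. *)
pose e k : R := harmonic k * (1 + c)^-1.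
have e0 k : 0 < e k by rewrite mulr_gt0 ?invr_gt0 ?ltr0n//; lra.
have ce k : 0 < 1 - e k * c.
  rewrite subr_gt0 /e -mulrA; apply: (@le_lt_trans _ _ ((1 + c)^-1 * c)).
    rewrite ler_piMl ?mulr_ge0 ?invr_ge0//; first lra.
    by rewrite /= invf_le1 ?ltr0n// ler1n.
  by rewrite mulrC ltr_pdivrMr; lra.
pose dz : 'rV[R]_d := \row_i ((pq i).1 - c * z 0 i).
(* Subtracting [q0] offsets the motion of [tau], so [v 0 i + tau] moves by exactly
   [e k * (pq i).2]. *)
pose dv : 'rV[R]_d := \row_i ((pq i).2 - q0).
have zE k i : (z + e k *: dz) 0 i = (1 - e k * c) * z 0 i + e k * (pq i).1.
  by rewrite !mxE; ring.
have sE k : 1 - \sum_i (z + e k *: dz) 0 i =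
    (1 - e k * c) * (1 - \sum_i z 0 i) + e k * p0.
  under eq_bigr do rewrite zE.
  by rewrite big_split /= -!mulr_sumr /c; ring.
have vE k i : (v + e k *: dv) 0 i + (tau + e k * q0) =
    v 0 i + tau + e k * (pq i).2.
  by rewrite !mxE; ring.
have hk k : kkt (z + e k *: dz) (v + e k *: dv) (tau + e k * q0).
  split.
  - split=> [i|].
      rewrite zE addr_ge0// mulr_ge0//; [exact: ltW|exact: ltW|].
      by have [] := Hpq i.
    rewrite -subr_ge0 sE addr_ge0// mulr_ge0//; [exact: ltW| |exact: ltW].
    exact: kkt_slack_ge0 hz.
  - by rewrite addr_ge0// mulr_ge0// ltW.
  - by rewrite sE; have [] := H0 _ _ (ce k) (e0 k).
  move=> i; rewrite vE zE; have [? ? H] := Hpq i; have [vi _] := vz i.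
  split; last by have [] := H _ _ (ce k) (e0 k).
  by rewrite addr_ge0// mulr_ge0// ltW.
exists (fun k => row_mx z (- v) + e k *: row_mx dz (- dv)).
(* Only the base point moves; the normal is already proximal at each perturbed point. *)
exists (fun=> row_mx zeta (- eta)).
have wE k : row_mx z (- v) + e k *: row_mx dz (- dv) =
    row_mx (z + e k *: dz) (- (v + e k *: dv)).
  by rewrite scale_row_mx add_row_mx scalerN opprD.
split.
- by move=> k; rewrite wE; apply/graphP; eexists; exact: hk.
- move=> k; rewrite wE; apply: (multiplier_proximal (hk k) (beta := beta)).
  split; first by rewrite sE; have [] := H0 _ _ (ce k) (e0 k).
  by move=> i; rewrite vE zE; have [_ _ H] := Hpq i; have [] := H _ _ (ce k) (e0 k).
- have e_cvg : e k @[k --> \oo] --> (0 : R).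
    by rewrite -(mul0r (1 + c)^-1); apply: cvgM; [exact: cvg_harmonic|exact: cvg_cst].
  rewrite -[X in _ --> X]addr0 -(scale0r (row_mx dz (- dv))).
  by apply: cvgD; [exact: cvg_cst|exact: cvgZr_tmp].
- exact: cvg_cst.
Qed.

(** The multipliers along the sequence are not assumed to converge. They are eventually determined
    by convergent data: entries of [v_ k] and [zeta_ k] at a support index of [z] if the cap is
    tight, and 0 if there is slack. *)
Lemma limiting_multiplier z v tau zeta eta : kkt z v tau ->
  limiting_normal_cone graph (row_mx z (- v)) (row_mx zeta (- eta)) ->
  exists beta, multiplier (@limiting_pair R) z v tau zeta eta beta.
Proof.
move=> hz [w_ [xi_ [wG prox w_cvg xi_cvg]]]; have [[z0 z1] tau0 tz vz] := hz.
have coord (u_ : nat -> 'rV[R]_(d + d)) (u : 'rV[R]_(d + d)) i :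
    u_ k @[k --> \oo] --> u ->
    u_ k 0 i @[k --> \oo] --> u 0 i.
  move=> cu; exact: (cvg_comp u_ (fun x : 'rV[R]_(d + d) => x 0 i) cu
      (@coord_continuous R _ _ 0 i u)).
pose z_ k := lsubmx (w_ k); pose v_ k := - rsubmx (w_ k).
pose zeta_ k := lsubmx (xi_ k); pose eta_ k := - rsubmx (xi_ k).
have wE k : w_ k = row_mx (z_ k) (- v_ k) by rewrite opprK hsubmxK.
have xiE k : xi_ k = row_mx (zeta_ k) (- eta_ k) by rewrite opprK hsubmxK.
have z_cvg i : z_ k 0 i @[k --> \oo] --> z 0 i.
  have := coord _ _ (lshift d i) w_cvg; rewrite row_mxEl.
  by under eq_fun do rewrite wE row_mxEl.
have zeta_cvg i : zeta_ k 0 i @[k --> \oo] --> zeta 0 i.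
  have := coord _ _ (lshift d i) xi_cvg; rewrite row_mxEl.
  by under eq_fun do rewrite xiE row_mxEl.
have v_cvg i : v_ k 0 i @[k --> \oo] --> v 0 i.
  rewrite -[v 0 i]opprK; under eq_fun do rewrite -[v_ _ 0 i]opprK.
  apply: cvgN; have := coord _ _ (rshift d i) w_cvg; rewrite row_mxEr mxE.
  by under eq_fun do rewrite wE row_mxEr mxE.
have eta_cvg i : eta_ k 0 i @[k --> \oo] --> eta 0 i.
  rewrite -[eta 0 i]opprK; under eq_fun do rewrite -[eta_ _ 0 i]opprK.
  apply: cvgN; have := coord _ _ (rshift d i) xi_cvg; rewrite row_mxEr mxE.
  by under eq_fun do rewrite xiE row_mxEr mxE.
have sum_cvg (f_ : nat -> 'rV[R]_d) (f : 'rV[R]_d) :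
    (forall i, f_ k 0 i @[k --> \oo] --> f 0 i) ->
    \sum_i f_ k 0 i @[k --> \oo] --> \sum_i f 0 i.
  by move=> cf; apply: cvg_big => //; exact: add_continuous.
have s_cvg : 1 - \sum_i z_ k 0 i @[k --> \oo] --> 1 - \sum_i z 0 i.
  by apply: cvgB; [exact: cvg_cst|exact: sum_cvg].
have e_cvg : - \sum_i eta_ k 0 i @[k --> \oo] --> - \sum_i eta 0 i.
  by apply: cvgN; exact: sum_cvg.
have mult k : exists t b, kkt (z_ k) (v_ k) t /\
    multiplier (@proximal_pair R) (z_ k) (v_ k) t (zeta_ k) (eta_ k) b.
  have := wG k; rewrite wE => /graphP[t ht].
  have := prox k; rewrite wE xiE => /(proximal_multiplier ht)[b hb].
  by exists t, b.
have closed (t_ b_ : nat -> R) beta :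
    t_ k @[k --> \oo] --> tau -> b_ k @[k --> \oo] --> beta ->
    (\forall k \near \oo, forall t b, kkt (z_ k) (v_ k) t ->
      multiplier (@proximal_pair R) (z_ k) (v_ k) t (zeta_ k) (eta_ k) b ->
      t = t_ k /\ b = b_ k) ->
    multiplier (@limiting_pair R) z v tau zeta eta beta.
  move=> t_cvg b_cvg tb.
  have H : \forall k \near \oo,
      multiplier (@limiting_pair R) (z_ k) (v_ k) (t_ k) (zeta_ k) (eta_ k) (b_ k).
    apply: filterS tb => k tbk; have [t [b [ht hb]]] := mult k.
    have [<- <-] := tbk t b ht hb; case: hb => hb0 hb.
    by split=> [|i]; exact: proximal_limiting_pair.
  split=> [|i].
    apply: (limiting_pair_cvg s_cvg t_cvg (cvgN b_cvg) e_cvg).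
    by apply: filterS H => k [].
  apply: (limiting_pair_cvg (z_cvg i) (cvgD (v_cvg i) t_cvg)
    (cvgB (zeta_cvg i) b_cvg) (eta_cvg i)).
  by apply: filterS H => k [_ /(_ i)].
have [z1' | z1'] := eqVneq (1 - \sum_i z 0 i) 0.
  have [|j zj] := capped_simplex_tight (conj z0 z1); first lra.
  exists (zeta 0 j); apply: (closed (fun k => - v_ k 0 j) (fun k => zeta_ k 0 j)).
  - have -> : tau = - v 0 j by have [_ ?] := vz j; nra.
    exact: cvgN.
  - exact: zeta_cvg.
  (* Positivity of [z 0 j] persists for large [k], and complementarity at [j] then fixes both
     multipliers. *)
  apply: filterS (cvgr_gt _ (z_cvg j) _ zj) => k zkj t b [_ _ _ /(_ j)[_ vt]].
  move=> [_ /(_ j)[zb _ _]].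
  by split; nra.
have s0 : 0 < 1 - \sum_i z 0 i by rewrite lt0r z1' subr_ge0.
have tau00 : tau = 0 by nra.
exists 0; apply: (closed (fun=> 0) (fun=> 0)).
- by rewrite tau00; exact: cvg_cst.
- exact: cvg_cst.
apply: filterS (cvgr_gt _ s_cvg _ s0) => k sk t b [_ _ st _] [[sb _ _] _].
by split; nra.
Qed.

(** The three index sets are the three states of a pair [(z 0 i, v 0 i + tau)]: first entry
    positive, second entry positive, or both zero. *)
Lemma limiting_normal_cone_formula z v tau : kkt z v tau ->
  limiting_normal_cone graph (row_mx z (- v)) =
  formula_cone z tau [set i | 0 < z 0 i]
    [set i | z 0 i = 0 /\ - tau < v 0 i] [set i | z 0 i = 0 /\ v 0 i = - tau].
Proof.
move=> hz; have [[z0 _] tau0 tz vz] := hz.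
apply/seteqP; split=> [w|w [zeta [eta [-> [beta [[sb te] P [ab ae] Q]]]]]].
  rewrite -[w]hsubmxK -[rsubmx w]opprK => /(limiting_multiplier hz)[beta].
  move: (lsubmx w) (- rsubmx w) => zeta eta [[sb te P] H].
  exists zeta, eta; split=> //; exists beta; split.
  - by split; lra.
  - by case: P => [[? ?]|?]; [left; split; lra|right; lra].
  - split=> i /=; have [za ve _] := H i; first by move=> zi; nra.
    by move=> [zi vi]; nra.
  by move=> i _; have [_ _ [[? ?]|?]] := H i; [left; split; lra|right].
apply: (multiplier_limiting hz (beta := beta)).
split; first split.
- by rewrite mulrN mulrC sb oppr0.
- by rewrite mulrN te oppr0.
- by case: P => [[? ?]|?]; [left; split; lra|right; lra].
move=> i; have [vi zvi] := vz i.
have := z0 i; rewrite le_eqVlt => /predU1P[/esym zi|zi].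
  move: vi; rewrite le_eqVlt => /predU1P[vi|vi].
    rewrite zi -vi; split; rewrite ?mul0r//.
    by case: (Q i _) => [|[? ?]|?]; [split => //; lra|left; split; lra|right].
  by rewrite zi (ae i) /=; [split; rewrite ?mul0r ?mulr0//; right|split; lra].
have -> : v 0 i + tau = 0 by nra.
by rewrite (ab i zi) subrr; split; rewrite ?mul0r ?mulr0//; right.
Qed.

End Limiting.

(** * The formula in the slack and tight cases *)

Theorem corollary3p12 (R : realType) (d : nat) (z v : 'rV[R]_d)
    (hz : capped_simplex R d z)
    (hv : gph (convex_normal_cone (capped_simplex R d)) (row_mx z (- v))) :
  let N := limiting_normal_cone (gph (convex_normal_cone (capped_simplex R d)))
             (row_mx z (- v)) in
  let L := [set i : 'I_d | 0 < z 0 i] in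
  (\sum_i z 0 i < 1 ->
    let tau : R := 0 in
    let Ip := [set i : 'I_d | z 0 i = 0 /\ 0 < v 0 i] in
    let I0 := [set i : 'I_d | z 0 i = 0 /\ v 0 i = 0] in
    N = formula_cone z tau L Ip I0)
  /\
  (\sum_i z 0 i = 1 ->
    [/\ L !=set0,
        (forall j k, L j -> L k -> v 0 j = v 0 k) &
        forall i0, L i0 ->
          let tau := - v 0 i0 in
          let Ip := [set i : 'I_d | z 0 i = 0 /\ - tau < v 0 i] in
          let I0 := [set i : 'I_d | z 0 i = 0 /\ v 0 i = - tau] in
          N = formula_cone z tau L Ip I0]).
Proof.
move: hv => /graphP[tau hk]; have [_ _ tz vz] := hk.
(* This identifies the multiplier supplied by [graphP] with [- v 0 j] for every support index
   [j]. *)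
have L_v j : 0 < z 0 j -> v 0 j + tau = 0.
  move=> zj; have [_ /eqP] := vz j.
  by rewrite mulf_eq0 gt_eqF// => /eqP.
split=> [z1 | z1].
  have tau0 : tau = 0.
    by move/eqP: tz; rewrite mulf_eq0 subr_eq0 gt_eqF// => /eqP.
  by have := limiting_normal_cone_formula hk; rewrite tau0 oppr0.
split.
- by have [j zj] := capped_simplex_tight hz z1; exists j.
- by move=> j k /L_v vj /L_v vk; lra.
move=> i0 /L_v vi0; have -> : v 0 i0 = - tau by lra.
rewrite opprK; exact: limiting_normal_cone_formula hk.
Qed.
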